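(* The integer $28$ is the only even perfect number that is a sum of two positive perfect cubes. That is, $28$ is an even perfect number with $28 = 3^3 + 1^3$, and if $n$ is an even perfect number such that $n = x^3 + a^3$ for some positive integers $x$ and $a$, then $n = 28$.
   Context: A positive integer $n$ is perfect if the sum of all its positive divisors (including $n$ itself) equals $2n$. *)

(* Defs.v *)
From mathcomp Require Import all_boot.
Set Implicit Arguments.
Unset Strict Implicit.
Unset Printing Implicit Defensive.

(* [divisors n] lists the positive divisors of n (once each) only when 0 < n. *)
Definition perfect (n : nat) : bool :=
  (0 < n) && (\sum_(d <- divisors n) d == 2 * n).

(* Main.v *)
(** By Euler's theorem an even perfect number is [2 ^ k * q] with
    [q = 2 ^ k.+1 - 1] prime.  Factor [x ^ 3 + a ^ 3 = s * t] where [s = x + a]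
    and [t = x ^ 2 - x a + a ^ 2], so that [s ^ 2 - t = 3 x a > 0] and
    [s ^ 2 <= 4 t].  If [q] divides [s], then [s ^ 2 <= 4 t] is violated.
    Otherwise [s = 2 ^ i] and [t = 2 ^ (k - i) q], and the two inequalities
    force [3 i = 2 k + 1] or [3 i = 2 k + 2].  In the first case
    [s ^ 2 - t = 2 ^ (k - i)], which is not divisible by 3; in the second case
    3 divides [k + 1], so 7 divides [q], whence [q = 7]. *)

Require Import Defs.
From mathcomp Require Import all_boot.
From mathcomp Require Import zify.

Set Implicit Arguments.
Unset Strict Implicit.
Unset Printing Implicit Defensive.

(** Multiplication maps pairs of divisors of [m] and [n] bijectively onto divisors of [m * n]; the
    inverse is [d |-> (gcdn d m, gcdn d n)]. *)
Lemma sum_divisors_coprime m n : 0 < m -> 0 < n -> coprime m n ->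
  \sum_(d <- divisors (m * n)) d =
  (\sum_(d <- divisors m) d) * \sum_(d <- divisors n) d.
Proof.
move=> m_gt0 n_gt0 co_mn.
have mn_gt0 : 0 < m * n by rewrite muln_gt0 m_gt0.
have gcdK d e : d %| m -> e %| n -> gcdn (d * e) m = d.
  move=> dm en; rewrite gcdnC Gauss_gcdl ?(coprime_dvdr en) //.
  exact/gcdn_idPr.
have gcdK' d e : d %| m -> e %| n -> gcdn (d * e) n = e.
  move=> dm en; rewrite gcdnC Gauss_gcdr; first exact/gcdn_idPr.
  by rewrite coprime_sym (coprime_dvdl dm).
rewrite (perm_big [seq d * e | d <- divisors m, e <- divisors n]) /=.
  rewrite big_allpairs_dep big_distrl /=.
  by apply: eq_bigr => d _; rewrite big_distrr.
apply: uniq_perm; first exact: divisors_uniq.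
  apply: allpairs_uniq; try exact: divisors_uniq.
  move=> u v /allpairsP[[d e] /= []]; rewrite -!dvdn_divisors // => dm en ->.
  move=> /allpairsP[[d' e'] /= []]; rewrite -!dvdn_divisors // => dm' en' -> /= eq.
  congr (_, _).
    by rewrite -(gcdK _ _ dm en) eq gcdK.
  by rewrite -(gcdK' _ _ dm en) eq gcdK'.
move=> d; rewrite -dvdn_divisors //; apply/idP/allpairsP => [d_mn | [[u v] /= []]].
  exists (gcdn d m, gcdn d n); rewrite -!dvdn_divisors // !dvdn_gcdr; split=> //=.
  apply/eqP; rewrite eqn_dvd; apply/andP; split.
    by rewrite muln_gcdl !muln_gcdr !dvdn_gcd d_mn dvdn_mulr // dvdn_mulr // dvdn_mull.
  rewrite Gauss_dvd ?dvdn_gcdl //.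
  by rewrite (coprime_dvdl (dvdn_gcdr d m)) // (coprime_dvdr (dvdn_gcdr d n)).
by rewrite -!dvdn_divisors // => um vn ->; apply: dvdn_mul.
Qed.

Lemma sum_divisors_exp2 k : \sum_(d <- divisors (2 ^ k)) d = 2 ^ k.+1 - 1.
Proof.
rewrite (perm_big [seq 2 ^ i | i <- iota 0 k.+1]); last first.
  apply: uniq_perm; first exact: divisors_uniq.
    by rewrite map_inj_uniq ?iota_uniq //; apply: expnI.
  move=> d; rewrite -dvdn_divisors ?expn_gt0 //.
  apply/(dvdn_pfactor _ _ (isT : prime 2))/mapP => [[i le_ik ->] | [i]].
    by exists i; rewrite // mem_iota.
  by rewrite mem_iota => /= lt_ik ->; exists i.
rewrite big_map -[iota _ _]/(index_iota 0 k.+1).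
elim: k => [|k IHk]; first by rewrite big_nat1.
by rewrite big_nat_recr //= IHk (expnS 2 k.+1); lia.
Qed.

(** The divisors [m] and [d] already exhaust the sum, so a third one would make it too large; since
    1 is a divisor, it must be [d]. *)
Lemma sum_divisors_prime m d : d %| m -> 0 < d < m ->
  \sum_(e <- divisors m) e = m + d -> d = 1 /\ prime m.
Proof.
move=> dm /andP[d_gt0 lt_dm] sum_m.
have m_gt0 : 0 < m by lia.
have div_m e : e %| m -> e = m \/ e = d.
  move=> em; have [->|ne_m] := eqVneq e m; first by left.
  have [->|ne_d] := eqVneq e d; first by right.
  have e_gt0 := dvdn_gt0 m_gt0 em.
  move: sum_m; rewrite (bigD1_seq m) ?divisors_uniq ?divisors_id //=.
  rewrite -big_filter (bigD1_seq d) ?filter_uniq ?divisors_uniq //=; last first.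
    by rewrite mem_filter -dvdn_divisors // dm andbT; lia.
  rewrite -big_filter (bigD1_seq e) ?filter_uniq ?divisors_uniq //=; last first.
    by rewrite !mem_filter -dvdn_divisors // em andbT; lia.
  by lia.
have d1 : d = 1 by have [] := div_m 1 (dvd1n m); lia.
split=> //; apply/primeP; split; first lia.
by move=> e /div_m[] ->; rewrite ?d1 eqxx ?orbT.
Qed.

Lemma even_perfect_Mersenne n : ~~ odd n -> perfect n ->
  exists k, [/\ 0 < k, prime (2 ^ k.+1 - 1) & n = 2 ^ k * (2 ^ k.+1 - 1)].
Proof.
move=> even_n /andP[n_gt0 /eqP sum_n].
have [m] := pfactor_coprime (isT : prime 2) n_gt0.
set k := logn 2 n => odd_m n_eq; exists k.
have k_gt0 : 0 < k.
  rewrite lt0n; apply: contraNneq even_n => k0.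
  by rewrite n_eq k0 muln1 -coprime2n.
have Q_gt1 : 1 < 2 ^ k by rewrite -{1}(expn0 2) ltn_exp2l.
have m_gt0 : 0 < m by rewrite lt0n; apply: contraTneq n_gt0 => m0; rewrite n_eq m0.
move: sum_n; rewrite n_eq sum_divisors_coprime ?expn_gt0 //; last first.
  by rewrite coprime_sym coprimeXl.
rewrite sum_divisors_exp2 expnS => sum_m.
(* Perfection reads [(2 * 2 ^ k - 1) * sigma(m) = 2 * 2 ^ k * m], and consecutive integers are
   coprime. *)
have q_m : 2 * 2 ^ k - 1 %| m.
  rewrite -(@Gauss_dvdl _ m (2 * 2 ^ k)).
    by apply/dvdnP; exists (\sum_(d <- divisors m) d); lia.
  rewrite -{2}(@subnK 1 (2 * 2 ^ k)); last lia.
  by rewrite addn1 coprimenS.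
have /dvdnP[c m_eq] := q_m.
have c_gt0 : 0 < c by case: c m_eq => [|//]; lia.
(* Cancelling [2 * 2 ^ k - 1] leaves [sigma(m) = 2 * 2 ^ k * c = m + c], with [c] a proper divisor
   of [m]. *)
have [c1 m_pr] : c = 1 /\ prime m.
  apply: sum_divisors_prime; [by rewrite m_eq dvdn_mulr | by nia |].
  apply/eqP; rewrite -(@eqn_pmul2r (2 * 2 ^ k - 1)); last lia.
  by apply/eqP; rewrite sum_m m_eq; nia.
by move: m_pr; rewrite m_eq c1 mul1n; split; rewrite // mulnC.
Qed.

(** By symmetry take [x = a + d]; then [t = a ^ 2 + a d + d ^ 2] involves no truncated subtraction,
    and [4 t - (x + a) ^ 2 = 3 d ^ 2]. *)
Lemma sum_cubes_factor x a :
  exists t, [/\ x ^ 3 + a ^ 3 = (x + a) * t, t + 3 * (x * a) = (x + a) ^ 2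
              & (x + a) ^ 2 <= 4 * t].
Proof.
wlog le_ax : x a / a <= x.
  move=> IH; have [/IH //|/ltnW/IH] := leqP a x.
  by rewrite (addnC (x ^ 3)) (addnC x) (mulnC x).
have -> : x = a + (x - a) by rewrite subnKC.
move: (x - a) => d; exists (a ^ 2 + a * d + d ^ 2).
by split; lia.
Qed.

Theorem mainTheorem1 :
  [/\ ~~ odd 28, perfect 28, 28 = 3 ^ 3 + 1 ^ 3 &
      forall n x a : nat,
        ~~ odd n -> perfect n -> 0 < x -> 0 < a ->
        n = x ^ 3 + a ^ 3 -> n = 28].
Proof.
split=> //; first by rewrite /perfect unlock.
move=> n x a even_n perf_n x_gt0 a_gt0 def_n.
have [k [k_gt0 q_pr n_eq]] := even_perfect_Mersenne even_n perf_n.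
have Q_gt1 : 1 < 2 ^ k by rewrite -{1}(expn0 2) ltn_exp2l.
have [t [n_st t_eq le_s2_4t]] := sum_cubes_factor x a.
have xa_gt0 : 0 < x * a by rewrite muln_gt0 x_gt0.
move: n_st t_eq le_s2_4t; rewrite -def_n n_eq.
have: 0 < x + a by lia.
move: (x + a) (x * a) xa_gt0 => s p p_gt0 s_gt0 st_eq t_eq le_s2_4t.
have := dvdn_mull (2 ^ k) (dvdnn (2 ^ k.+1 - 1)).
rewrite st_eq Euclid_dvdM // => /orP[] /dvdnP[c c_eq].
  have tc : c * t = 2 ^ k.
    apply/eqP; rewrite -(@eqn_pmul2r (2 ^ k.+1 - 1)); last exact: prime_gt0.
    by apply/eqP; rewrite st_eq c_eq; lia.
  have c_gt0 : 0 < c by case: c {tc} c_eq => [|//]; lia.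
  have t_le : t <= 2 ^ k by rewrite -tc leq_pmull.
  have s_ge : 2 * 2 ^ k - 1 <= s by rewrite c_eq expnS leq_pmull.
  (* With [Q = 2 ^ k >= 2], the bounds give [(2 Q - 1) ^ 2 <= 4 Q], which is false. *)
  by nia.
have sc : s * c = 2 ^ k.
  apply/eqP; rewrite -(@eqn_pmul2r (2 ^ k.+1 - 1)); last exact: prime_gt0.
  by apply/eqP; rewrite st_eq c_eq; lia.
have /(dvdn_pfactor _ _ (isT : prime 2))[i _ s_eq] : s %| 2 ^ k.
  by rewrite -sc dvdn_mulr.
have /(dvdn_pfactor _ _ (isT : prime 2))[j _ cj_eq] : c %| 2 ^ k.
  by rewrite -sc dvdn_mull.
have k_eq : k = i + j.
  by apply: (@expnI 2) => //; rewrite expnD -s_eq -cj_eq.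
have J_gt0 : 0 < 2 ^ j by rewrite expn_gt0.
have I_gt0 : 0 < 2 ^ i by rewrite expn_gt0.
have t_ij : t = 2 ^ j * (2 * (2 ^ i * 2 ^ j) - 1).
  by rewrite c_eq cj_eq k_eq expnS expnD.
(* Here [s ^ 2 <= 4 t < 8 * 2 ^ i * 2 ^ (2 j)]; divide by [2 ^ i]. *)
have i_lt : i < 2 * j + 3.
  rewrite -(@ltn_exp2l 2) // expnD mulnC (mulnC 2) expnM.
  move: le_s2_4t; rewrite t_ij s_eq; nia.
(* Otherwise [s ^ 2 <= 2 ^ i * 2 ^ (2 j) <= t], contradicting [p > 0]. *)
have i_gt : 2 * j < i.
  rewrite ltnNge -(@leq_exp2l 2) // mulnC expnM; apply/negP => le_ij.
  by move: t_eq; rewrite t_ij s_eq; nia.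
have [i_eq|i_eq] : i = j * 2 + 1 \/ i = j * 2 + 2 by lia.
  (* With [J = 2 ^ j], [s ^ 2 = 4 J ^ 4] and [t = 4 J ^ 4 - J], so [3 p = J], and 3 would divide a
     power of 2. *)
  have /(dvdn_pfactor _ _ (isT : prime 2)) [l _] : 3 * p %| 2 ^ j.
    move: t_eq; rewrite t_ij s_eq i_eq expnD expnM => t_eq.
    by have -> : 2 ^ j = 3 * p by nia.
  move=> /(congr1 (dvdn 3)); rewrite dvdn_mulr //.
  by case: l => // l; rewrite Euclid_dvdX.
have k1_eq : k.+1 = 3 * j.+1 by lia.
(* [8 - 1] divides [8 ^ j.+1 - 1], which is prime. *)
have q7 : 2 ^ k.+1 - 1 = 7.
  apply/eqP; rewrite eq_sym -dvdn_prime2 //.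
  by rewrite k1_eq expnM -[X in _ - X](exp1n j.+1) subn_exp dvdn_mulr.
by rewrite -st_eq q7; move: q7; rewrite expnS; lia.
Qed.
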